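(* Let $n\ge 4$. Let $C_3^{n-3}$ be the graph obtained from a triangle $K_3$ and a path $w_1w_2\cdots w_{n-3}$ on $n-3$ new vertices by adding an edge between $w_1$ and one vertex of the triangle. Then $C_3^{n-3}$ is, up to isomorphism, the unique graph attaining the minimum algebraic connectivity over $\mathfrak{H}_{n,1}$; that is, $\mu(C_3^{n-3})<\mu(G)$ for every $G\in\mathfrak{H}_{n,1}$ not isomorphic to $C_3^{n-3}$.
   Context: All graphs are finite, simple and undirected. The Laplacian matrix of $G$ is $L(G)=D(G)-A(G)$ (degree matrix minus adjacency matrix), and the algebraic connectivity $\mu(G)$ is the second smallest eigenvalue of $L(G)$. A pendant vertex is a vertex of degree one. $\mathfrak{H}_{n,k}$ denotes the class of all connected graphs on $n$ vertices having exactly $k$ pendant vertices. *)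

(* Defs.v *)
From HB Require Import structures.
From mathcomp Require Import all_boot all_order all_algebra.
From mathcomp Require Import polyrcf.
From mathcomp Require Import reals.

Set Implicit Arguments.
Unset Strict Implicit.
Unset Printing Implicit Defensive.

Import Order.TTheory GRing.Theory Num.Theory.
Local Open Scope ring_scope.

(* Simple undirected graphs on the vertex set {0, ..., n-1}. *)
Record graph (n : nat) := Graph {
  adj :> rel 'I_n;
  adj_sym : symmetric adj;
  adj_irr : irreflexive adj
}.

Section Graphs.
Variable n : nat.
Implicit Types G H : graph n.

Definition degree G (i : 'I_n) : nat := #|[set j | G i j]|.

Definition pendant G (i : 'I_n) : bool := degree G i == 1%N.

Definition connected G : Prop := forall i j : 'I_n, connect G i j.

Definition isomorphic G H : Prop :=
  exists2 f : 'I_n -> 'I_n, bijective f & forall i j, H (f i) (f j) = G i j.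

(* The class of connected graphs with exactly k pendant vertices. *)
Definition HH (k : nat) G : Prop :=
  connected G /\ #|[set i | pendant G i]| = k.

End Graphs.

Section Laplacian.
Variables (R : realType) (n : nat).

Definition adjacency_mx (G : graph n) : 'M[R]_n :=
  \matrix_(i, j) (G i j)%:R.

Definition degree_mx (G : graph n) : 'M[R]_n :=
  diag_mx (\row_i (degree G i)%:R).

Definition laplacian (G : graph n) : 'M[R]_n :=
  degree_mx G - adjacency_mx G.

(* The real eigenvalues in increasing order, repeated according to algebraic
   multiplicity; [rootsR p] is the increasing list of the distinct real roots
   of p.  For a symmetric matrix this list has length n. *)
Definition spectrum (A : 'M[R]_n) : seq R :=
  flatten [seq nseq (mup x (char_poly A)) x | x <- rootsR (char_poly A)].

(* The list is indexed from 0, so index 1 is the second smallest entry; the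
   default value 0 is only relevant for n < 2. *)
Definition algebraic_connectivity (G : graph n) : R :=
  nth 0 (spectrum (laplacian G)) 1.

End Laplacian.

(* C_3^{n-3} on {0, ..., n-1}: the triangle is {0, 1, 2}, and the path vertex
   w_k is k + 2, so that w_1 = 3 is attached to the triangle vertex 2. *)
Definition C3tail_arc (i j : nat) : bool :=
  ([|| i < j < 3, (i == 2) && (j == 3) | (3 <= i) && (j == i.+1)])%N.

Definition C3tail_adj (n : nat) : rel 'I_n :=
  fun i j => C3tail_arc i j || C3tail_arc j i.

Lemma C3tail_sym n : symmetric (@C3tail_adj n).
Proof. by move=> i j; rewrite /C3tail_adj orbC. Qed.

Lemma C3tail_irr n : irreflexive (@C3tail_adj n).
Proof.
move=> i; rewrite /C3tail_adj orbb /C3tail_arc ltnn /= (ltn_eqF (ltnSn i)).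
by rewrite andbF orbF; case: eqP => // ->.
Qed.

Definition C3tail (n : nat) : graph n := Graph (@C3tail_sym n) (@C3tail_irr n).

(* Main.v *)
(* Let f be a Fiedler vector of G and relabel G so that its values become
   y_0 >= y_1 >= ... >= y_(n-1).  As n >= 4 and G has a single pendant vertex,
   replacing f by -f if necessary we may assume that vertices 0 and 1 are not
   pendant.  With h_k = y_k - y_(k+1), an edge {i, j} contributes the square of
   h_i + ... + h_(j-1), hence at least the sum of the h_k^2.  Connectedness
   makes every cut between k and k+1 be crossed, and deg 0, deg 1 >= 2 make the
   first two cuts be crossed twice and some edge from 0 jump over both of them,
   so that
     E_G(y) >= 2 h_0^2 + 2 h_1^2 + 2 h_0 h_1 + \sum_(k >= 2) h_k^2,
   and the right-hand side is exactly the energy of y placed on C_3^{n-3} along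
   the labels.  By the variational characterisation of mu this gives
   mu(C_3^{n-3}) <= mu(G).
   In case of equality y is an eigenvector of C_3^{n-3}, whose eigenvalue
   equations force h_k > 0 for all k >= 1; then an edge of G that is not an edge
   of C_3^{n-3} would make the energy inequality strict, so G is contained in
   C_3^{n-3}, and the crossing conditions give equality. *)

Require Import Defs.
From mathcomp Require Import all_boot all_order all_fingroup all_algebra.
From mathcomp Require Import polyrcf complex spectral.
From mathcomp Require Import reals ring lra zify.

Set Implicit Arguments.
Unset Strict Implicit.
Unset Printing Implicit Defensive.

Import Order.TTheory GRing.Theory Num.Theory.
Local Open Scope ring_scope.

(** * Diagonalisation of real symmetric matrices *)

Section SpectralTheorem.
Local Open Scope sesquilinear_scope.
Variables (R : rcfType) (n : nat).
Local Notation toC := (real_complex R).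

(* Obtained from the spectral theorem for normal matrices over R[i],
   hence a complex diagonalising matrix although the eigenvalues are real. *)
Lemma real_symmetric_spectral (A : 'M[R]_n) : A^T = A ->
  exists (P : 'M[R[i]]_n) (d : 'rV[R]_n), P \is unitarymx /\
    map_mx toC A = P ^t* *m diag_mx (map_mx toC d) *m P.
Proof.
move=> symA; set B := map_mx toC A.
have realB : B \is a realmx.
  by apply/mxOverP => i j; rewrite mxE complex_real.
have hermB : B \is hermsymmx.
  apply: realsym_hermsym => //; apply/is_hermitianmxP.
  apply/matrixP => i j; rewrite expr0 scale1r !mxE -{1}symA mxE.
  by [].
have uP := spectral_unitarymx B.
exists (spectralmx B), (map_mx (@complex.Re R) (spectral_diag B)); split=> //.
have /orthomx_spectralP := hermitian_normalmx hermB.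
move: uP (hermitian_spectral_diag_real hermB).
move: (spectralmx B) (spectral_diag B) => P D uP realD ->.
have -> : map_mx toC (map_mx (@complex.Re R) D) = D.
  by apply/rowP => i; rewrite !mxE; apply/RRe_real/mxOverP.
by rewrite (invmx_unitary uP).
Qed.

(** Since [P] is unitary, [A] is similar to a diagonal matrix; the factorisation obtained over
    [R[i]] descends because the embedding of real polynomials is injective. *)
Lemma char_poly_spectral (A : 'M[R]_n) (P : 'M[R[i]]_n) (d : 'rV[R]_n) :
  P \is unitarymx -> map_mx toC A = P ^t* *m diag_mx (map_mx toC d) *m P ->
  char_poly A = \prod_(i < n) ('X - (d 0 i)%:P).
Proof.
move=> uP eA; apply: (@map_poly_inj _ _ toC).
rewrite map_char_poly eA rmorph_prod /=.
set D := diag_mx _.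
have -> : char_poly (P ^t* *m D *m P) = char_poly D.
  pose Q := map_mx polyC P; pose Q' := map_mx polyC (P ^t*).
  have QQ : Q' *m Q = 1%:M.
    rewrite -map_mxM /= -invmx_unitary // mulVmx ?map_mx1 //.
    exact: unitarymx_unit.
  have -> : char_poly (P ^t* *m D *m P) = \det (Q' *m char_poly_mx D *m Q).
    congr (\det _); rewrite /char_poly_mx !map_mxM /= -/Q -/Q'.
    by rewrite mulmxBr mulmxBl scalar_mxC -(mulmxA 'X%:M) QQ mulmx1.
  rewrite !det_mulmx mulrC mulrA -det_mulmx (mulmx1C QQ).
  by rewrite det1 mul1r.
rewrite char_poly_trig ?diag_mx_is_trig //.
apply: eq_bigr => i _; rewrite !mxE eqxx mulr1n.
by rewrite rmorphB /= map_polyX map_polyC.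
Qed.

End SpectralTheorem.

(** * Multiplicities and order in the list [spectrum] *)

Lemma mup_prod_XsubC_seq (R : fieldType) (x : R) (s : seq R) :
  mup x (\prod_(z <- s) ('X - z%:P)) = count_mem x s.
Proof.
elim: s => [|z s IHs]; first by rewrite big_nil mupNroot // root1.
rewrite big_cons mupM ?polyXsubC_eq0 //; last first.
  by apply/monic_neq0/monic_prod => i _; apply: monicXsubC.
by rewrite IHs -['X - _]expr1 mup_XsubCX /=; case: (z == x).
Qed.

Section Spectrum.
Variables (R : realType) (n : nat).

Lemma count_spectrum (A : 'M[R]_n) x :
  count_mem x (spectrum A) = mup x (char_poly A).
Proof.
set p := char_poly A.
have p0 : p != 0 by apply/monic_neq0/char_poly_monic.
have cnt (s : seq R) : uniq s ->
    count_mem x (flatten [seq nseq (mup z p) z | z <- s])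
    = if x \in s then mup x p else 0%N.
  elim: s => //= z s IHs /andP[zs us].
  rewrite count_cat IHs // inE count_nseq /=.
  rewrite (eq_sym x) /=; have [zx|_] := eqVneq z x; last by rewrite mul0n.
  by rewrite -zx (negPf zs) mul1n addn0.
rewrite /spectrum cnt ?uniq_roots //.
case: ifPn => // xs; rewrite mupNroot //; apply: contra xs => rx.
exact: (root_roots_on (roots_on_rootsR p0)).
Qed.

Lemma sorted_spectrum (A : 'M[R]_n) : sorted <=%R (spectrum A).
Proof.
have srt (m : R -> nat) (s : seq R) : sorted <%R s ->
    sorted <=%R (flatten [seq nseq (m x) x | x <- s]).
  rewrite lt_sorted_pairwise le_sorted_pairwise.
  elim: s => //= z s IHs /andP[zs us].
  rewrite pairwise_cat IHs // andbT; apply/andP; split; last first.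
    elim: (m z) => //= k ->; rewrite andbT; apply/allP => w.
    by rewrite mem_nseq => /andP[_ /eqP->].
  apply/allrelP => u v; rewrite mem_nseq => /andP[_ /eqP->].
  case/flatten_mapP => w ws; rewrite mem_nseq => /andP[_ /eqP->].
  exact/ltW/(allP zs).
exact/(srt (fun x => mup x (char_poly A)))/sorted_roots.
Qed.

(** Links the root-list definition of [spectrum] to a diagonalisation: in both lists a value occurs
    as often as its multiplicity as a root. *)
Lemma perm_spectrum (A : 'M[R]_n) (d : 'rV[R]_n) :
  char_poly A = \prod_(i < n) ('X - (d 0 i)%:P) ->
  perm_eq (spectrum A) [seq d 0 i | i : 'I_n].
Proof.
move=> eA; apply/allP => x _ /=; rewrite count_spectrum eA.
by rewrite -mup_prod_XsubC_seq big_image.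
Qed.

End Spectrum.

(** * The Laplacian quadratic form *)

Section LaplacianForm.
Variables (R : realType) (n : nat).
Implicit Types (G : graph n) (x : 'rV[R]_n).

(* The sum ranges over ordered pairs: every edge is counted twice. *)
Definition energy G (x : 'I_n -> R) : R :=
  \sum_i \sum_j (G i j)%:R * (x i - x j) ^+ 2.

Lemma laplacian_sym G : (laplacian R G)^T = laplacian R G.
Proof.
apply/matrixP => i j; rewrite !mxE adj_sym.
by have [->|] := eqVneq i j.
Qed.

Lemma mul_laplacian G x j :
  (x *m laplacian R G) 0 j = \sum_i (G j i)%:R * (x 0 j - x 0 i).
Proof.
rewrite mulmxBr mxE mul_mx_diag !mxE.
have -> : (degree G j)%:R = \sum_i (G j i)%:R :> R.
  rewrite /degree -sum1_card natr_sum big_mkcond /=.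
  by apply: eq_bigr => i _; rewrite inE; case: (G j i).
rewrite mulr_sumr -sumrB; apply: eq_bigr => i _.
by rewrite !mxE (adj_sym G i j) mulrBr mulrC [X in _ - X]mulrC.
Qed.

Lemma laplacian_form G x :
  energy G (x 0) = 2 * (x *m laplacian R G *m x^T) 0 0.
Proof.
rewrite mxE; under [in RHS]eq_bigr => j _ do rewrite mul_laplacian mxE.
(* The form is doubled and the summation indices are swapped in one copy; the two contributions of
   an ordered pair then add up to its term in the energy. *)
pose F j i := (G j i)%:R * (x 0 j - x 0 i) * x 0 j.
rewrite mulr_natl mulr2n {2}(eq_bigr (fun j => \sum_i F j i)) => [|j _].
  2: by rewrite mulr_suml.
rewrite exchange_big /= -big_split /=; apply: eq_bigr => i _.
rewrite mulr_suml -big_split /=; apply: eq_bigr => j _.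
by rewrite /F (adj_sym G j i); ring.
Qed.

Lemma energy_ge0 G x : 0 <= energy G (x 0).
Proof.
by do 2![apply: sumr_ge0 => ? _]; rewrite mulr_ge0 ?ler0n ?sqr_ge0.
Qed.

(** Zero energy forces equal values across every edge, and paths spread this to all vertices. *)
Lemma laplacian_ker G x : connected G -> x *m laplacian R G = 0 ->
  forall i j, x 0 i = x 0 j.
Proof.
move=> cG xL i j.
have E0 : energy G (x 0) = 0 by rewrite laplacian_form xL mul0mx mxE mulr0.
have adjE u v : G u v -> x 0 u = x 0 v.
  move=> uv; apply/eqP; rewrite -subr_eq0 -(sqrf_eq0).
  have ge0 u' v' : 0 <= (G u' v')%:R * (x 0 u' - x 0 v') ^+ 2.
    by rewrite mulr_ge0 ?ler0n ?sqr_ge0.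
  move/eqP: E0; rewrite psumr_eq0; last by move=> ? _; apply: sumr_ge0.
  move=> /allP/(_ u (mem_index_enum u)) /=; rewrite psumr_eq0 //.
  by move=> /allP/(_ v (mem_index_enum v)) /=; rewrite uv mul1r.
have /connectP[p pth ->] := cG i j.
elim: p i pth => //= k p IHp i /andP[ik pth].
by rewrite (adjE _ _ ik) -IHp.
Qed.

End LaplacianForm.

Lemma normsq_rV (R : pzRingType) n (x : 'rV[R]_n) :
  (x *m x^T) 0 0 = \sum_i x 0 i ^+ 2.
Proof. by rewrite mxE; apply: eq_bigr => i _; rewrite mxE expr2. Qed.

Lemma normsq_rV_gt0 (R : realDomainType) n (x : 'rV[R]_n) :
  x != 0 -> 0 < (x *m x^T) 0 0.
Proof.
move=> x0; rewrite normsq_rV lt_neqAle sumr_ge0 ?andbT => [|i _]; last first.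
  exact: sqr_ge0.
apply: contraNneq x0 => /esym/eqP.
rewrite psumr_eq0 => [/allP z|i _]; last exact: sqr_ge0.
apply/eqP/rowP => i; rewrite mxE; apply/eqP; rewrite -sqrf_eq0.
exact: z (mem_index_enum i).
Qed.

(** * Variational characterisation of the algebraic connectivity *)

Section AlgebraicConnectivity.
Local Open Scope sesquilinear_scope.
Variables (R : realType) (n : nat).
Local Notation toC := (real_complex R).

Lemma spectral_form (A : 'M[R]_n) (P : 'M[R[i]]_n) (e x : 'rV[R]_n) :
  map_mx toC A = P ^t* *m diag_mx (map_mx toC e) *m P ->
  let c := map_mx toC x *m P ^t* in
  toC ((x *m A *m x^T) 0 0) = \sum_k toC (e 0 k) * `|c 0 k| ^+ 2.
Proof.
move=> eA c.
have -> : toC ((x *m A *m x^T) 0 0) = (map_mx toC (x *m A *m x^T)) 0 0.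
  by rewrite [RHS]mxE.
rewrite !map_mxM /= eA !mulmxA -/c -mulmxA.
have -> : P *m map_mx toC x^T = c ^t*.
  apply/matrixP => i j; rewrite !mxE rmorph_sum /=; apply: eq_bigr => k _.
  by rewrite !mxE rmorphM /= conjCK (CrealP _) ?complex_real // mulrC.
rewrite mul_mx_diag mxE; apply: eq_bigr => k _.
by rewrite !mxE normCK -mulrA mulrCA.
Qed.

Variable G : graph n.
Hypotheses (cG : connected G) (n2 : (1 < n)%N).
Local Notation L := (laplacian R G).
Local Notation mu := (algebraic_connectivity R G).

Lemma laplacian_eigenvalue_ge0 a : root (char_poly L) a -> 0 <= a.
Proof.
rewrite -eigenvalue_root_char => /eigenvalueP[v vL v0].
have := energy_ge0 G v; rewrite laplacian_form vL -scalemxAl mxE.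
by rewrite pmulr_rge0 ?ltr0n // pmulr_lge0 // normsq_rV_gt0.
Qed.

(** The rows of the diagonalising matrix are complex, so the kernel is needed over [R[i]]. Forming
    [kermx] commutes with the field extension, and the rows of the real kernel are constant. *)
Lemma laplacian_kerC (v : 'rV[R[i]]_n) :
  v *m map_mx toC L = 0 -> forall i j, v 0 i = v 0 j.
Proof.
move=> /eqP; rewrite -sub_kermx -map_kermx => vK.
have kK : (kermx L <= (const_mx 1 : 'rV_n))%MS.
  apply/row_subP => k; set u := row k _.
  have uL : u *m L = 0 by rewrite /u -row_mul mulmx_ker row0.
  have uc := laplacian_ker cG uL.
  apply/sub_rVP; exists (u 0 (Ordinal (ltnW n2))); apply/rowP => j.
  by rewrite [RHS]mxE [const_mx _ _ _]mxE mulr1; apply: uc.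
have /sub_rVP[a ->] : (v <= (const_mx 1 : 'rV_n))%MS.
  apply: submx_trans vK _; rewrite -(map_const_mx toC).
  by rewrite map_submx.
by move=> i j; rewrite !mxE.
Qed.

Lemma laplacian_const : const_mx 1 *m L = 0 :> 'rV_n.
Proof.
apply/rowP => j; rewrite mul_laplacian [RHS]mxE big1 // => i _.
by rewrite !mxE subrr mulr0.
Qed.

Section Decomposition.
Variables (P : 'M[R[i]]_n) (d : 'rV[R]_n).
Hypotheses (uP : P \is unitarymx)
  (eL : map_mx toC L = P ^t* *m diag_mx (map_mx toC d) *m P).

Lemma row_spectral k : row k P *m map_mx toC L = toC (d 0 k) *: row k P.
Proof.
rewrite -row_mul eL !mulmxA (unitarymxP uP) mul1mx row_mul.
apply/rowP => j; rewrite !mxE (bigD1 k) //= !mxE eqxx mulr1n big1 ?addr0 //.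
by move=> i ik; rewrite !mxE eq_sym (negPf ik) mul0r.
Qed.

(** Rows of [P] for the eigenvalue 0 are constant, and two constant rows of norm 1 cannot be
    orthogonal. *)
Lemma spectral_diag_eq0 k l : d 0 k = 0 -> d 0 l = 0 -> k = l.
Proof.
move=> dk dl; apply/eqP/negPn/negP => kl.
have Kk : forall i j, (row k P) 0 i = (row k P) 0 j.
  by apply: laplacian_kerC; rewrite row_spectral dk scale0r.
have Kl : forall i j, (row l P) 0 i = (row l P) 0 j.
  by apply: laplacian_kerC; rewrite row_spectral dl scale0r.
pose z := Ordinal (ltnW n2).
have dotE u v : (forall i j, (row u P) 0 i = (row u P) 0 j) ->
    (forall i j, (row v P) 0 i = (row v P) 0 j) ->
    (u == v)%:R = n%:R * (P u z * (P v z)^*).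
  move=> Ku Kv; have /matrixP/(_ u v) := unitarymxP uP.
  rewrite [RHS]mxE => <-; rewrite mxE (eq_bigr (fun=> P u z * (P v z)^*)).
    by rewrite sumr_const card_ord mulr_natl.
  move=> i _; rewrite !mxE.
  by have := Ku i z; have := Kv i z; rewrite !mxE => -> ->.
have nC : n%:R != 0 :> R[i] by rewrite pnatr_eq0 -lt0n ltnW.
have := dotE _ _ Kk Kl; rewrite (negPf kl) => /esym/eqP.
rewrite !mulf_eq0 (negPf nC) conjC_eq0 /= => /orP[] /eqP E.
  have := dotE _ _ Kk Kk; rewrite E mul0r mulr0 eqxx => /eqP.
  by rewrite oner_eq0.
have := dotE _ _ Kl Kl; rewrite E mul0r mulr0 eqxx => /eqP.
by rewrite oner_eq0.
Qed.

(** The eigenvalue 0 is the least entry of the spectrum and occurs only once, so the entry of index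
    1 is positive and bounds every nonzero one from below. *)
Lemma spectral_diag_gap : [/\ 0 < mu, root (char_poly L) mu &
  forall k, d 0 k = 0 \/ mu <= d 0 k].
Proof.
have cp := char_poly_spectral uP eL.
have pm := perm_spectrum cp.
have rt a : a \in spectrum L -> root (char_poly L) a.
  rewrite (perm_mem pm) cp => /imageP[i _ ->].
  rewrite -(big_map (fun i => d 0 i) xpredT (fun z => 'X - z%:P)).
  by rewrite root_prod_XsubC map_f ?mem_index_enum.
have s0 : 0 \in spectrum L.
  rewrite (perm_mem pm) -[_ \in _](root_prod_XsubC) big_image -cp.
  rewrite -eigenvalue_root_char; apply/eigenvalueP; exists (const_mx 1).
    by rewrite laplacian_const scale0r.
  apply/eqP => /rowP/(_ (Ordinal (ltnW n2)))/eqP.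
  by rewrite !mxE oner_eq0.
have us : (count_mem 0%R (spectrum L) <= 1)%N.
  rewrite (seq.permP pm) /image_mem count_map -size_filter.
  have : uniq [seq i <- enum 'I_n | (preim (fun i => d 0 i) (pred1 0)) i].
    by rewrite filter_uniq ?enum_uniq.
  have : {in [seq i <- enum 'I_n | (preim (fun i => d 0 i) (pred1 0)) i] &,
     forall i j, i = j}.
    move=> i j; rewrite !mem_filter /= => /andP[/eqP di _] /andP[/eqP dj _].
    exact: spectral_diag_eq0.
  case: [seq _ <- _ | _] => [|i [|j s]] //= eqij.
  by rewrite (eqij i j) ?inE ?eqxx ?orbT.
have dS k : d 0 k \in spectrum L by rewrite (perm_mem pm) image_f.
have sz : size (spectrum L) = n by rewrite (perm_size pm) size_image card_ord.
have := sorted_spectrum L; rewrite /algebraic_connectivity.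
case: (spectrum L) sz s0 us dS rt => [|a [|b s]] /= sz s0 us dS rt.
- by have := n2; rewrite -[X in (_ < X)%N]sz.
- by have := n2; rewrite -[X in (_ < X)%N]sz.
rewrite le_path_sortedE /= => /andP[ab /andP[bs _]]; rewrite -/(b :: s) in s0.
have a0 : a = 0.
  apply/eqP; rewrite eq_le.
  rewrite (laplacian_eigenvalue_ge0 (rt _ _)) ?inE ?eqxx // andbT.
  move: s0; rewrite inE => /orP[/eqP->//|/=]; rewrite inE => /orP[/eqP->//|].
  by move=> /(allP bs); apply: le_trans.
split.
- rewrite lt_neqAle -{2}a0 ab andbT; move: us; rewrite a0 eqxx.
  by case: eqVneq => // ->; rewrite eqxx.
- by rewrite rt // !inE eqxx orbT.
move=> k; have := dS k; rewrite !inE => /or3P[/eqP->|/eqP->|ks].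
- by left.
- by right.
by right; apply: (allP bs).
Qed.

Lemma spectral_coord_eq0 (x : 'rV[R]_n) k : \sum_i x 0 i = 0 ->
  d 0 k = 0 -> (map_mx toC x *m P ^t*) 0 k = 0.
Proof.
move=> x1 dk.
have Kk : forall i j, (row k P) 0 i = (row k P) 0 j.
  by apply: laplacian_kerC; rewrite row_spectral dk scale0r.
rewrite mxE (eq_bigr (fun i => toC (x 0 i) * (P k (Ordinal (ltnW n2)))^*)).
  by rewrite -mulr_suml -rmorph_sum x1 rmorph0 mul0r.
move=> i _; rewrite !mxE.
by have := Kk i (Ordinal (ltnW n2)); rewrite !mxE => ->.
Qed.

End Decomposition.

Lemma algebraic_connectivity_gt0 : 0 < mu.
Proof.
have [P [d [uP eL]]] := real_symmetric_spectral (laplacian_sym R G).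
by have [] := spectral_diag_gap uP eL.
Qed.

Lemma fiedler_vector : exists2 f : 'rV[R]_n, f != 0 &
  \sum_i f 0 i = 0 /\ f *m L = mu *: f.
Proof.
have [P [d [uP eL]]] := real_symmetric_spectral (laplacian_sym R G).
have [mu0 + _] := spectral_diag_gap uP eL.
rewrite -eigenvalue_root_char => /eigenvalueP[f fL f0]; exists f => //.
split=> //.
(* Pairing the eigenvector equation with the all-ones vector, which [L] annihilates, leaves [mu]
   times the sum of [f] equal to 0. *)
have /matrixP/(_ 0 0) := congr1 (mulmxr (const_mx 1 : 'rV[R]_n)^T) fL.
rewrite /= -mulmxA -[X in _ *m (X *m _)](laplacian_sym R G) -trmx_mul.
rewrite laplacian_const trmx0 mulmx0 -scalemxAl ![_ 0 0]mxE => /esym/eqP.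
rewrite mulf_eq0 gt_eqF //= => /eqP f1; rewrite -[RHS]f1.
apply: eq_bigr => i _.
by rewrite !mxE mulr1.
Qed.

(** In the eigenbasis the form of [L - mu] is a sum of nonnegative terms: an eigenvalue 0 meets a
    zero coordinate of [x], and the others are at least [mu]. Equality makes each term vanish, so
    [x] is killed by [L - mu]. *)
Lemma algebraic_connectivity_min (x : 'rV[R]_n) : \sum_i x 0 i = 0 ->
  mu * (x *m x^T) 0 0 <= (x *m L *m x^T) 0 0 ?= iff (x *m L == mu *: x).
Proof.
move=> x1.
have [P [d [uP eL]]] := real_symmetric_spectral (laplacian_sym R G).
have [mu0 _ gap] := spectral_diag_gap uP eL.
pose e := d - const_mx mu; pose B := L - mu%:M.
have eB : map_mx toC B = P ^t* *m diag_mx (map_mx toC e) *m P.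
  rewrite /B /e (map_mxB _ L) (map_mxB _ d) /= eL map_scalar_mx map_const_mx.
  rewrite raddfB /= diag_const_mx.
  rewrite mulmxBr mulmxBl scalar_mxC -(mulmxA (toC mu)%:M) -invmx_unitary //.
  by rewrite mulVmx ?mulmx1 // unitarymx_unit.
have xB : x *m B = x *m L - mu *: x by rewrite mulmxBr mul_mx_scalar.
pose c := map_mx toC x *m P ^t*.
have t0 k : 0 <= toC (e 0 k) * `|c 0 k| ^+ 2.
  case: (gap k) => dk; last first.
    by rewrite mulr_ge0 ?exprn_ge0 // lecR !mxE subr_ge0.
  by rewrite /c (spectral_coord_eq0 uP eL x1 dk) normr0 expr0n /= mulr0.
have fB := spectral_form x eB; rewrite -/c in fB.
have xBx : (x *m B *m x^T) 0 0 = (x *m L *m x^T) 0 0 - mu * (x *m x^T) 0 0.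
  by rewrite xB mulmxBl -scalemxAl !mxE.
split; first by rewrite -subr_ge0 -xBx -lecR fB sumr_ge0.
rewrite eq_sym -subr_eq0 -xBx; apply/eqP/eqP => [xB0|xL]; last first.
  by rewrite xB xL subrr mul0mx mxE.
apply/eqP; rewrite -subr_eq0 -xB -(map_mx_eq0 toC) map_mxM /= eB !mulmxA -/c.
suff cD : c *m diag_mx (map_mx toC e) = 0 by rewrite [X in X *m P]cD mul0mx.
apply/rowP => k; rewrite mul_mx_diag !mxE.
move: fB; rewrite xB0 => /esym/eqP; rewrite psumr_eq0 // => /allP/(_ k).
rewrite mem_index_enum mulf_eq0 sqrf_eq0 normr_eq0 => /(_ isT) /orP[]/eqP.
  by rewrite !mxE => ->; rewrite mulr0.
by rewrite mxE => ->; rewrite mul0r.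
Qed.

End AlgebraicConnectivity.

(** * Relabelling the vertices *)

Section Relabel.
Variable n : nat.
Implicit Types (G : graph n) (s : {perm 'I_n}).

Lemma relabel_sym G s : symmetric (fun i j => G (s i) (s j)).
Proof. by move=> i j; rewrite adj_sym. Qed.

Lemma relabel_irr G s : irreflexive (fun i j => G (s i) (s j)).
Proof. by move=> i; rewrite adj_irr. Qed.

Definition relabel G s : graph n := Graph (relabel_sym G s) (relabel_irr G s).

Lemma relabel_isomorphic G s : isomorphic (relabel G s) G.
Proof. by exists s => //; apply: injF_bij perm_inj. Qed.

Lemma relabel_connected G s : connected G -> connected (relabel G s).
Proof.
move=> cG i j; have /connectP[p] := cG (s i) (s j).
elim: p i => [|k p IHp] i /=; first by move=> _ /perm_inj ->.
case/andP=> ik pth lst; apply: (@connect_trans _ _ ((s^-1)%g k)).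
  by apply: connect1; rewrite /= permKV.
by apply: IHp; rewrite permKV.
Qed.

Lemma relabel_degree G s i : degree (relabel G s) i = degree G (s i).
Proof.
rewrite /degree -(card_imset _ (@perm_inj _ s)); apply: eq_card => j.
apply/imsetP/idP => [[k + ->]|sj]; first by rewrite !inE.
by exists ((s^-1)%g j); rewrite ?permKV //; move: sj; rewrite !inE /= permKV.
Qed.

Lemma energy_relabel (R : realType) G s (x : 'I_n -> R) :
  energy (relabel G s) (x \o s) = energy G x.
Proof.
rewrite /energy [RHS](reindex_inj (@perm_inj _ s)) /=; apply: eq_bigr => i _.
by rewrite [RHS](reindex_inj (@perm_inj _ s)).
Qed.

End Relabel.

Lemma nonincreasing_perm (R : realDomainType) n (f : 'I_n -> R) :
  exists s : {perm 'I_n}, forall i j : 'I_n, (i <= j)%N -> f (s j) <= f (s i).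
Proof.
pose r i j := f j <= f i; pose t := sort r (enum 'I_n).
have szt : size t = n by rewrite size_sort size_enum_ord.
have ut : uniq t by rewrite sort_uniq enum_uniq.
pose g (i : 'I_n) := nth i t i.
have ginj : injective g.
  move=> i j; rewrite /g (set_nth_default j) ?szt // => /eqP.
  by rewrite nth_uniq ?szt // => /eqP/val_inj.
exists (perm ginj) => i j ij; rewrite !permE /g (set_nth_default i j) ?szt //.
have tr : transitive r by move=> a b c ba ac; apply: le_trans ba.
have st : sorted r t by apply: sort_sorted => a b; apply: le_total.
by apply: (sorted_leq_nth tr) => //; rewrite ?inE ?szt // => a; apply: lexx.
Qed.

(** * Degrees, crossing edges and the flow through a cut *)

Lemma degree_gt0 n (G : graph n) i :
  connected G -> (1 < n)%N -> (0 < degree G i)%N.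
Proof.
move=> cG n1; have [j ij] : exists j, j != i.
  have : (0 < #|[set~ i]|)%N.
    by rewrite cardsC1 card_ord; case: n {G i cG} n1 => [|[]].
  by case/card_gt0P => j; rewrite !inE; exists j.
have /connectP[[|k p] /=] := cG i j; first by move=> _ /eqP; rewrite (negPf ij).
by case/andP=> ik _ _; apply/card_gt0P; exists k; rewrite inE.
Qed.

Lemma degree_gt1P n (G : graph n) i v :
  (1 < degree G i)%N -> exists2 j, G i j & j != v.
Proof.
move=> d1; have /card_gt0P[j] : (0 < #|[set j | G i j] :\ v|)%N.
  by move: d1; rewrite /degree (cardsD1 v); case: (_ \in _) => //; lia.
by rewrite !inE => /andP[jv ij]; exists j.
Qed.

Lemma degree_gt1 n (G : graph n) i j k :
  G i j -> G i k -> j != k -> (1 < degree G i)%N.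
Proof.
move=> ij ik jk; have <- : #|[set j; k]| = 2%N by rewrite cards2 jk.
by apply/subset_leq_card/subsetP => l; rewrite !inE => /orP[]/eqP->.
Qed.

Lemma connect_crossing (T : finType) (e : rel T) (a : pred T) x y :
  connect e x y -> a x -> ~~ a y -> exists u v, [/\ e u v, a u & ~~ a v].
Proof.
case/connectP=> p; elim: p x => [|z p IHp] x /=; first by move=> _ -> ->.
case/andP=> xz pth ylst ax nay; have [az|naz] := boolP (a z).
  exact: IHp pth ylst az nay.
by exists x, z.
Qed.

(** Terms of edges inside [a] cancel by antisymmetry; only the flow across the boundary survives. *)
Lemma laplacian_cut (R : realType) n (G : graph n) (x : 'rV[R]_n)
    (a : pred 'I_n) :
  \sum_(j | a j) (x *m laplacian R G) 0 j =
  \sum_(j | a j) \sum_(i | ~~ a i) (G j i)%:R * (x 0 j - x 0 i).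
Proof.
pose F j i := (G j i)%:R * (x 0 j - x 0 i).
pose S := \sum_(j | a j) \sum_(i | a i) F j i.
have S0 : S = 0.
  suff : S = - S by lra.
  rewrite {1}/S exchange_big /= -sumrN; apply: eq_bigr => i _.
  rewrite -sumrN; apply: eq_bigr => j _.
  by rewrite /F (adj_sym G j i); ring.
transitivity (S + \sum_(j | a j) \sum_(i | ~~ a i) F j i).
  rewrite -big_split /=; apply: eq_bigr => j _.
  by rewrite mul_laplacian (bigID a).
by rewrite S0 add0r.
Qed.

(** * Lower bounds for squared differences in terms of gaps *)

Section Gaps.
Variables (R : realType) (n : nat) (y : nat -> R).
Hypothesis yd : forall i j, (i <= j < n)%N -> y j <= y i.

Definition gap k : R := y k - y k.+1.

(* The part of (y i - y j) ^+ 2, expanded in terms of the gaps, that survives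
   the comparison: it is all of it exactly for the arcs of the target graph
   (the cross term is the one of the triangle edge {0, 2}). *)
Definition weight i j : R :=
  \sum_(i <= k < j) gap k ^+ 2
    + ((i == 0) && (2 <= j))%N%:R * (2 * gap 0 * gap 1).

Lemma gap_ge0 k : (k.+1 < n)%N -> 0 <= gap k.
Proof. by move=> kn; rewrite subr_ge0 yd // leqnSn. Qed.

Lemma sqr_diffS i j : (y i - y j.+1) ^+ 2 =
  (y i - y j) ^+ 2 + gap j ^+ 2 + 2 * (gap j * (y i - y j)).
Proof. by rewrite /gap; ring. Qed.

Lemma weightS i j : (i < j)%N -> weight i j.+1 =
  weight i j + gap j ^+ 2 + ((i == 0) && (j == 1))%N%:R * (2 * gap 0 * gap 1).
Proof.
move=> ij; rewrite /weight big_nat_recr ?(ltnW ij) //=.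
have -> : ((i == 0) && (1 < j.+1)
           = (i == 0) && (1 < j) || (i == 0) && (j == 1))%N by lia.
case: j ij => [|[|j]] //=; rewrite ?andbT ?andbF ?orbF /=.
  by move=> ?; ring.
by move=> ?; case: (i == 0)%N => /=; ring.
Qed.

Lemma weight_succ i : weight i i.+1 = gap i ^+ 2.
Proof.
by rewrite /weight big_nat1; case: i => [|i] /=; rewrite mul0r addr0.
Qed.

Lemma weight02 : weight 0 2 = (y 0 - y 2) ^+ 2.
Proof. by rewrite weightS // weight_succ /gap /=; ring. Qed.

(** Induction on [j]: each step adds to the square [gap j ^+ 2] and a nonnegative cross term. The
    latter is dropped, except from (0, 1) to (0, 2), where [weight] keeps it. *)
Lemma weight_le i j : (i < j < n)%N -> weight i j <= (y i - y j) ^+ 2.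
Proof.
elim: j => // j IHj /andP[]; rewrite ltnS leq_eqVlt => /orP[/eqP->|ij] jn.
  by rewrite weight_succ.
have /IHj wij : (i < j < n)%N by lia.
have [/andP[/eqP-> /eqP->]|ne] := boolP ((i == 0) && (j == 1))%N.
  by rewrite weight02.
rewrite weightS // (negPf ne) mul0r addr0.
have gj := gap_ge0 jn; have yij : 0 <= y i - y j by rewrite subr_ge0 yd //; lia.
by rewrite sqr_diffS; have := mulr_ge0 gj yij; lra.
Qed.

Lemma weight_arc i j :
  (i < j)%N -> C3tail_arc i j -> weight i j = (y i - y j) ^+ 2.
Proof.
move=> ij a; have [->|[-> ->]] : (j = i.+1 \/ i = 0 /\ j = 2)%N.
- by move: a; rewrite /C3tail_arc; lia.
- exact: weight_succ.
- exact: weight02.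
Qed.

(** A non-arc has [j >= 3] and [i <= j - 2]. The last step drops the product of gap [j - 1] with the
    difference of [y] from [i] to [j - 1]; both are positive, as only gap 0 may vanish. *)
Lemma weight_lt i j : (forall k, (0 < k)%N -> (k.+1 < n)%N -> 0 < gap k) ->
  (i < j < n)%N -> ~~ C3tail_arc i j -> weight i j < (y i - y j) ^+ 2.
Proof.
move=> gp; case: j => // j ijn na.
have [ij j2] : (i < j)%N /\ (1 < j)%N.
  by move: na ijn; rewrite /C3tail_arc; lia.
have wij : weight i j <= (y i - y j) ^+ 2 by apply: weight_le; lia.
rewrite weightS // (_ : _ && _ = false) ?mul0r ?addr0; last by lia.
have gj : 0 < gap j by apply: gp; lia.
have yij : 0 < y i - y j.
  have g1 : 0 < gap j.-1 by apply: gp; lia.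
  have y1 : y j.-1 <= y i by apply: yd; lia.
  by move: g1; rewrite /gap prednK; [lra|lia].
by rewrite sqr_diffS; have := mulr_gt0 gj yij; lra.
Qed.

End Gaps.

(** * Counting edges across cuts *)

Section Cuts.
Variable n : nat.
Implicit Type G : graph n.

Definition arcs G : {set 'I_n * 'I_n} := [set e | G e.1 e.2 && (e.1 < e.2)%N].
Definition cut G k : {set 'I_n * 'I_n} :=
  [set e in arcs G | (e.1 <= k < e.2)%N].
(** These are the arcs whose [weight] contains the cross term. *)
Definition far G : {set 'I_n * 'I_n} :=
  [set e in arcs G | (e.1 == 0 :> nat) && (2 <= e.2)%N].

Lemma energy_arcs (R : realType) G (x : 'I_n -> R) :
  energy G x = 2 * \sum_(e in arcs G) (x e.1 - x e.2) ^+ 2.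
Proof.
rewrite /energy pair_bigA /= (bigID (fun e : 'I_n * 'I_n => (e.1 < e.2)%N)) /=.
rewrite [X in _ + X](_ : _ = \sum_(e : 'I_n * 'I_n | (e.1 < e.2)%N)
    (G e.1 e.2)%:R * (x e.1 - x e.2) ^+ 2).
  rewrite -mulr2n -[LHS]mulr_natl; congr (_ * _).
  rewrite [RHS](eq_bigl (fun e : 'I_n * 'I_n => (e.1 < e.2)%N && G e.1 e.2))
    => [|e]; last by rewrite inE andbC.
  rewrite [RHS]big_mkcondr /=; apply: eq_bigr => e _.
  by case: (G _ _); rewrite ?mul1r ?mul0r.
rewrite (bigID (fun e : 'I_n * 'I_n => e.1 == e.2)) /= big1 ?add0r; last first.
  by move=> e /andP[_ /eqP->]; rewrite adj_irr mul0r.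
rewrite (reindex_inj (h := fun e : 'I_n * 'I_n => (e.2, e.1))) /=; last first.
  by move=> [a b] [c d] [-> ->].
apply: eq_big => [e|e _]; last by rewrite adj_sym; ring.
by rewrite -leqNgt leq_eqVlt -(inj_eq val_inj) /=; lia.
Qed.

Lemma sum_weight (R : realType) G (y : nat -> R) :
  \sum_(e in arcs G) weight y e.1 e.2 =
  \sum_(0 <= k < n.-1) #|cut G k|%:R * gap y k ^+ 2
    + #|far G|%:R * (2 * gap y 0 * gap y 1).
Proof.
rewrite /weight big_split /=; congr (_ + _); last first.
  rewrite -mulr_suml; congr (_ * _); rewrite -sum1_card natr_sum.
  rewrite [RHS](eq_bigl (fun e : 'I_n * 'I_n =>
      (e \in arcs G) && ((e.1 == 0 :> nat) && (1 < e.2)%N))).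
    by rewrite [RHS]big_mkcondr; apply: eq_bigr => e _; case: (_ && _).
  by move=> e; rewrite inE.
(* Each arc spans gaps among 0, ..., n-2; an indicator makes the range independent of the arc, so
   that the sums can be exchanged. *)
transitivity (\sum_(e in arcs G) \sum_(0 <= k < n.-1)
    ((e.1 <= k < e.2)%N%:R * gap y k ^+ 2)).
  apply: eq_bigr => e; rewrite inE => /andP[_ lt12].
  rewrite (@big_nat_widenl _ _ _ _ 0) // (@big_nat_widen _ _ _ _ _ n.-1).
    2: by have := ltn_ord e.2; lia.
  rewrite big_mkcond; apply: eq_bigr => k _ /=.
  by case: (_ && _); rewrite ?mul1r ?mul0r.
rewrite exchange_big /=; apply: eq_bigr => k _.
rewrite -mulr_suml; congr (_ * _); rewrite -sum1_card natr_sum.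
rewrite [RHS](eq_bigl (fun e : 'I_n * 'I_n =>
    (e \in arcs G) && (e.1 <= k < e.2)%N)).
  by rewrite [RHS]big_mkcondr; apply: eq_bigr => e _; case: (_ && _).
by move=> e; rewrite inE.
Qed.

End Cuts.

Lemma card_le_size (T : finType) (U : eqType) (A : {set T}) (f : T -> U)
    (s : seq U) :
  injective f -> (forall x, x \in A -> f x \in s) -> (#|A| <= size s)%N.
Proof.
move=> finj fA; rewrite cardE -(size_map f); apply: uniq_leq_size.
  by rewrite map_inj_uniq ?enum_uniq.
by move=> _ /mapP[x + ->]; rewrite mem_enum; apply: fA.
Qed.

(** * Energy comparison with C_3^{n-3} *)

Section Tail.
Variables (n : nat) (hn : (4 <= n)%N).
Local Notation L := (C3tail n).

Let lt0n : (0 < n)%N. Proof. by lia. Qed.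
Let lt1n : (1 < n)%N. Proof. by lia. Qed.
Let lt2n : (2 < n)%N. Proof. by lia. Qed.
Let v0 : 'I_n := Ordinal lt0n.
Let v1 : 'I_n := Ordinal lt1n.
Let v2 : 'I_n := Ordinal lt2n.

Lemma tailE (i j : 'I_n) : L i j = C3tail_arc i j || C3tail_arc j i.
Proof. by []. Qed.

Lemma arcs_tail e : (e \in arcs L) = C3tail_arc e.1 e.2.
Proof. by rewrite inE tailE /C3tail_arc; lia. Qed.

Lemma tail_connected : connected L.
Proof.
have to0 (i : 'I_n) : connect L i v0.
  case: i => i; elim: i => [|i IHi] lt_in.
    by rewrite (_ : Ordinal _ = v0) ?connect0 //; apply: val_inj.
  have lt_in' : (i < n)%N by lia.
  apply: connect_trans (IHi lt_in'); apply: connect1.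
  by rewrite tailE /C3tail_arc /=; lia.
move=> i j; apply: connect_trans (to0 i) _.
by rewrite (sym_connect_sym (adj_sym L)).
Qed.

Lemma tail_pendant i : pendant L i = (i == n.-1 :> nat).
Proof.
rewrite /pendant; have [il|il] := eqVneq (i : nat) n.-1.
  have lt' : (n.-2 < n)%N by lia.
  rewrite /degree (_ : [set j | L i j] = [set Ordinal lt']) ?cards1 //.
  apply/setP => j; rewrite !inE tailE /C3tail_arc -(inj_eq val_inj) /= il.
  by have := ltn_ord j; lia.
apply/negbTE; rewrite neq_ltn; apply/orP; right.
have lt_in := ltn_ord i; have lti : (i.+1 < n)%N by lia.
have lti' : (i.-1 < n)%N by lia.
have [i0|i0] := posnP i.
  by apply: (@degree_gt1 _ _ _ v1 v2); rewrite // tailE /C3tail_arc /= i0.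
apply: (@degree_gt1 _ _ _ (Ordinal lti) (Ordinal lti')).
- by rewrite tailE /C3tail_arc /=; lia.
- by rewrite tailE /C3tail_arc /=; lia.
- by rewrite -(inj_eq val_inj) /=; lia.
Qed.

Lemma tail_HH : HH 1 L.
Proof.
split; first exact: tail_connected.
have lt' : (n.-1 < n)%N by lia.
rewrite (_ : [set i | _] = [set Ordinal lt']) ?cards1 //.
by apply/setP => i; rewrite !inE tail_pendant -(inj_eq val_inj).
Qed.

(** The crossing edges are {0,1} and {0,2} for [k = 0], {0,2} and {1,2} for [k = 1], and only
    {k,k+1} beyond. *)
Lemma cut_tail k : (#|cut L k| <= (k < 2).+1)%N.
Proof.
have vinj : injective (fun e : 'I_n * 'I_n => (val e.1, val e.2)).
  by move=> [a b] [c d] [/val_inj-> /val_inj->].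
have bound s : (forall i j, C3tail_arc i j -> (i <= k < j)%N -> (i, j) \in s) ->
    (#|cut L k| <= size s)%N.
  move=> sP; apply: (card_le_size vinj) => e.
  by rewrite inE arcs_tail => /andP[a lt]; apply: sP.
case: (ltnP k 2) => k2.
  apply: (@bound [:: (0, 2); if k == 0 then (0, 1) else (1, 2)]%N) => i j.
  rewrite /C3tail_arc !inE; by case: (k =P 0)%N => k0; rewrite !xpair_eqE; lia.
apply: (@bound [:: (k, k.+1)]) => i j.
by rewrite /C3tail_arc inE xpair_eqE; lia.
Qed.

Lemma far_tail : (#|far L| <= 1)%N.
Proof.
apply: (@card_le_size _ _ _ (fun e => (val e.1, val e.2)) [:: (0, 2)]%N).
  by move=> [a b] [c d] [/val_inj-> /val_inj->].
move=> e; rewrite inE arcs_tail /C3tail_arc inE xpair_eqE /=; lia.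
Qed.

Variable H : graph n.
Hypotheses (cH : connected H)
  (degH : forall i : 'I_n, (i < 2)%N -> (1 < degree H i)%N).

Let d0 : (1 < degree H v0)%N. Proof. exact: degH. Qed.
Let d1 : (1 < degree H v1)%N. Proof. exact: degH. Qed.

Lemma crossing k : (k.+1 < n)%N ->
  exists u v : 'I_n, [/\ H u v, (u <= k)%N & (k < v)%N].
Proof.
move=> kn; have lt' : (n.-1 < n)%N by lia.
have [||u [v [uv uk]]] := @connect_crossing _ _ (fun i : 'I_n => i <= k)%N _ _
    (cH v0 (Ordinal lt')) => //=; first by lia.
by rewrite -ltnNge => kv; exists u, v.
Qed.

Lemma far_neighbour0 : exists2 a : 'I_n, H v0 a & (2 <= a)%N.
Proof.
have [a va a1] := degree_gt1P v1 d0; exists a => //.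
have a0 : a != v0 by apply: contraTneq va => ->; rewrite adj_irr.
by move: a0 a1; rewrite -!(inj_eq val_inj) /=; lia.
Qed.

Lemma far_neighbour1 : exists2 b : 'I_n, H v1 b & (2 <= b)%N.
Proof.
have [a va a1] := degree_gt1P v0 d1; exists a => //.
have a0 : a != v1 by apply: contraTneq va => ->; rewrite adj_irr.
by move: a0 a1; rewrite -!(inj_eq val_inj) /=; lia.
Qed.

(** For [k = 0] two edges at vertex 0 cross; for [k = 1] one edge from 0 and one from 1 reach a
    label at least 2; for larger [k] connectedness gives one edge. *)
Lemma cut_ge k : (k.+1 < n)%N -> ((k < 2).+1 <= #|cut H k|)%N.
Proof.
move=> kn; case: (ltnP k 2) => k2; last first.
  have [u [v [uv uk kv]]] := crossing kn; apply/card_gt0P; exists (u, v).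
  by rewrite !inE /= uv; lia.
have two (e f : 'I_n * 'I_n) : e \in cut H k -> f \in cut H k -> e != f ->
    (2 <= #|cut H k|)%N.
  move=> eC fC ef; have <- : #|[set e; f]| = 2%N by rewrite cards2 ef.
  apply/subset_leq_card/subsetP => g.
  by rewrite in_set2 => /orP[]/eqP->.
have [a va a2] := far_neighbour0.
have [k0|k0] := posnP k.
  have [b vb ba] := degree_gt1P a d0.
  have b0 : b != v0 by apply: contraTneq vb => ->; rewrite adj_irr.
  apply: (@two (v0, a) (v0, b)).
  all: rewrite ?inE /= ?va ?vb ?xpair_eqE ?eqxx 1?eq_sym //=.
    by lia.
  by move: b0; rewrite -(inj_eq val_inj) /=; lia.
have [b vb b2] := far_neighbour1.
by apply: (@two (v0, a) (v1, b)); rewrite ?inE /= ?va ?vb //=; lia.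
Qed.

Lemma far_ge : (1 <= #|far H|)%N.
Proof.
have [a va a2] := far_neighbour0.
by apply/card_gt0P; exists (v0, a); rewrite !inE /= va a2 /=; lia.
Qed.

Section Energy.
Variables (R : realType) (y : nat -> R).
Hypothesis yd : forall i j, (i <= j < n)%N -> y j <= y i.

(** On the tail graph [weight] is the exact square, and every coefficient of the gap expansion is at
    most the one for [H]. *)
Let sum_weight_le :
  \sum_(e in arcs L) (y e.1 - y e.2) ^+ 2
    <= \sum_(e in arcs H) weight y e.1 e.2.
Proof.
rewrite (eq_bigr (fun e : 'I_n * 'I_n => weight y e.1 e.2)) => [|e eL].
  2: by rewrite weight_arc -?arcs_tail //; move: eL; rewrite inE => /andP[].
rewrite !sum_weight; apply: lerD; last first.
  apply: ler_wpM2r; last by rewrite ler_nat (leq_trans far_tail far_ge).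
  by rewrite !mulr_ge0 // (gap_ge0 yd) //; lia.
rewrite !big_mkord; apply: ler_sum => k _.
apply: ler_wpM2r; first exact: sqr_ge0.
rewrite ler_nat (leq_trans (cut_tail k)) // cut_ge //.
by have := ltn_ord k; lia.
Qed.

Let weight_sqr (e : 'I_n * 'I_n) : e \in arcs H ->
  weight y e.1 e.2 <= (y e.1 - y e.2) ^+ 2.
Proof.
by rewrite inE => /andP[_ lt12]; apply: (weight_le yd); rewrite lt12 /=.
Qed.

Lemma energy_tail_le : energy L (fun i => y i) <= energy H (fun i => y i).
Proof.
rewrite !energy_arcs ler_pM2l ?ltr0n //; apply: le_trans sum_weight_le _.
exact: ler_sum.
Qed.

Lemma energy_tail_eq : (forall k, (0 < k)%N -> (k.+1 < n)%N -> 0 < gap y k) ->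
  energy L (fun i => y i) = energy H (fun i => y i) ->
  forall e, e \in arcs H -> C3tail_arc e.1 e.2.
Proof.
move=> gp /eqP + e eH; rewrite !energy_arcs; apply: contraTT => na.
rewrite lt_eqF // ltr_pM2l ?ltr0n //; apply: le_lt_trans sum_weight_le _.
rewrite (bigD1 e) //= [ltRHS](bigD1 e) //=; apply: ltr_leD; last first.
  by apply: ler_sum => f /andP[fH _]; apply: weight_sqr.
apply: (weight_lt yd) => //; move: eH; rewrite inE => /andP[_ ->] /=.
exact: ltn_ord.
Qed.

End Energy.

(** Inside the tail graph each edge is forced: only {i,i+1} can cross the cut at [i >= 2], and the
    degree conditions at 0 and 1 leave no choice but the triangle edges. *)
Lemma tail_of_arcs : (forall e, e \in arcs H -> C3tail_arc e.1 e.2) -> H =2 L.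
Proof.
move=> sub.
have HL i j : H i j -> L i j.
  move=> ij; rewrite tailE; have [lt|lt|/val_inj E] := ltngtP i j.
  - by rewrite (sub (i, j)) // inE /= ij.
  - by rewrite orbC (sub (j, i)) // inE /= adj_sym ij.
  - by rewrite E adj_irr in ij.
have LH (i j : 'I_n) : C3tail_arc i j -> H i j.
  move=> a; have [i2|i2] := leqP 2 i.
    have ji : j = i.+1 :> nat by move: a; rewrite /C3tail_arc; lia.
    have [|u [v [uv ui iv]]] := @crossing i; first by rewrite -ji.
    have : L u v by apply: HL.
    rewrite tailE /C3tail_arc => uv'.
    have [-> ->] : i = u /\ j = v by split; apply: val_inj => /=; lia.
    by [].
  have [i0|i0] := posnP i.
    have -> : i = v0 by apply: val_inj.
    have [j1|j1] := eqVneq (j : nat) 1%N.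
      have [b vb b2] := degree_gt1P v2 d0.
      suff -> : j = b by [].
      apply: val_inj; have := HL _ _ vb; rewrite tailE /C3tail_arc /=.
      by move: b2; rewrite -(inj_eq val_inj) /=; lia.
    have [b vb b2] := far_neighbour0.
    suff -> : j = b by [].
    apply: val_inj; have := HL _ _ vb; rewrite tailE /C3tail_arc /=.
    by move: a; rewrite /C3tail_arc; lia.
  have -> : i = v1 by apply: val_inj => /=; lia.
  have [b vb b2] := far_neighbour1.
  suff -> : j = b by [].
  apply: val_inj; have := HL _ _ vb; rewrite tailE /C3tail_arc /=.
  by move: a; rewrite /C3tail_arc; lia.
move=> i j; apply/idP/idP; first exact: HL.
by rewrite tailE => /orP[/LH//|/LH]; rewrite adj_sym.
Qed.

End Tail.

(** * Strict gaps of a sorted eigenvector of C_3^{n-3} *)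

Lemma partial_sum_gt0 (R : realDomainType) n (z : 'I_n -> R) k :
  (forall i j : 'I_n, (i <= j)%N -> z j <= z i) -> \sum_i z i = 0 ->
  (exists i, z i != 0) -> (k.+1 < n)%N -> 0 < \sum_(i : 'I_n | (i <= k)%N) z i.
Proof.
move=> zd z0 [i0 zi0] kn; have lt_kn := ltnW kn.
pose w : 'I_n := Ordinal lt_kn; pose w' : 'I_n := Ordinal kn.
have lt0n : (0 < n)%N by lia.
pose v0 : 'I_n := Ordinal lt0n.
have zv0 : 0 < z v0.
  rewrite ltNge; apply: contra zi0 => v0_le0.
  have zle0 i : 0 <= - z i by rewrite oppr_ge0 (le_trans _ v0_le0) ?zd.
  have : \sum_i - z i == 0 by rewrite sumrN z0 oppr0.
  rewrite psumr_eq0 // => /allP/(_ i0 (mem_index_enum _)) /=.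
  by rewrite oppr_eq0.
(* If [z] is nonnegative up to [k], its positive first entry decides; otherwise all later entries
   are negative, and the total is 0. *)
have [zk|zk] := leP 0 (z w).
  rewrite (bigD1 v0) //= ltr_wpDr // sumr_ge0 // => i /andP[ik _].
  by rewrite (le_trans zk) ?zd.
have tail_lt0 (i : 'I_n) : (k < i)%N -> z i < 0.
  by move=> ki; rewrite (le_lt_trans _ zk) // zd //= ltnW.
move: z0; rewrite (bigID (fun i : 'I_n => (i <= k)%N)) /=.
rewrite [X in _ + X](bigD1 w') /= -?ltnNge //.
have := tail_lt0 w' (ltnSn k).
have : \sum_(i : 'I_n | ~~ (i <= k)%N && (i != w')) z i <= 0.
  by apply: sumr_le0 => i /andP[]; rewrite -ltnNge => /tail_lt0/ltW.
lra.
Qed.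

Section TailEigenvector.
Variables (R : realType) (n : nat) (hn : (4 <= n)%N) (y : nat -> R) (lam : R).
Local Notation L := (C3tail n).
Let z : 'rV[R]_n := \row_i y i.
Hypotheses (yd : forall i j, (i <= j < n)%N -> y j <= y i)
  (lam0 : 0 < lam) (zL : z *m laplacian R L = lam *: z)
  (z_sum : \sum_i z 0 i = 0) (z0 : z != 0).

Let z_antitone (i j : 'I_n) : (i <= j)%N -> z 0 j <= z 0 i.
Proof. by move=> ij; rewrite !mxE yd ?ij /=. Qed.

Let z_neq0 : exists i, z 0 i != 0.
Proof. by have /rV0Pn[i zi] := z0; exists i. Qed.

(** Summing the eigenvector equations over the labels up to [k] gives [lam] times a positive partial
    sum. *)
Let flow k : (k.+1 < n)%N ->
  0 < \sum_(j : 'I_n | (j <= k)%N) \sum_(i : 'I_n | ~~ (i <= k)%N)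
        (L j i)%:R * (y j - y i).
Proof.
move=> kn; have := partial_sum_gt0 z_antitone z_sum z_neq0 kn.
rewrite -(pmulr_rgt0 _ lam0) mulr_sumr.
rewrite (eq_bigr (fun i => (z *m laplacian R L) 0 i)) => [|i _]; last first.
  by rewrite zL [RHS]mxE.
rewrite laplacian_cut.
set F := (X in 0 < X -> _); set F' := (X in _ -> 0 < X).
suff -> : F = F' by [].
apply: eq_bigr => j _; apply: eq_bigr => i _.
by rewrite !mxE.
Qed.

Let vertex_eq (j : 'I_n) : \sum_i (L j i)%:R * (y j - y i) = lam * y j.
Proof.
transitivity ((z *m laplacian R L) 0 j); last by rewrite zL !mxE.
by rewrite mul_laplacian; apply: eq_bigr => i _; rewrite !mxE.
Qed.

(** For [k >= 2] the edge {k,k+1} alone carries the positive flow, so its gap cannot vanish. For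
    [k = 1] the equations at vertex 1 and at the pendant vertex are combined. *)
Lemma tail_eigenvector_gap k : (0 < k)%N -> (k.+1 < n)%N -> 0 < gap y k.
Proof.
move=> k0 kn; rewrite lt_neqAle (gap_ge0 yd) // andbT eq_sym.
apply/eqP => gk; have [k2|k2] := leqP 2 k.
  have := flow kn; rewrite big1 ?ltxx // => j jk; rewrite big1 // => i ik.
  rewrite tailE; have [a|] := boolP (_ || _); last by rewrite mul0r.
  have [-> ->] : j = k :> nat /\ i = k.+1 :> nat.
    by move: a jk ik; rewrite /C3tail_arc; lia.
  by rewrite -/(gap y k) gk mulr0.
(* With y_1 = y_2 the equation at vertex 1 reads y_0 = (1 - lam) y_1; as y_0 > 0 and y_0 >= y_1,
   this gives y_1 < 0 and lam > 1. Then y_(n-2) = (1 - lam) y_(n-1) is positive, against y_(n-2) <=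
   y_2 < 0. *)
have k1 : k = 1%N by lia.
rewrite k1 /gap in gk.
have lt0n : (0 < n)%N by lia.
have lt1n : (1 < n)%N by lia.
have lt2n : (2 < n)%N by lia.
have ltl : (n.-1 < n)%N by lia.
have ltl' : (n.-2 < n)%N by lia.
have y0 : 0 < y 0.
  have := partial_sum_gt0 z_antitone z_sum z_neq0 lt1n.
  rewrite (big_pred1 (Ordinal lt0n)) ?mxE // => i.
  by rewrite /= -(inj_eq val_inj) /=; lia.
have := vertex_eq (Ordinal lt1n).
rewrite (bigD1 (Ordinal lt0n)) // (bigD1 (Ordinal lt2n)) //= big1; last first.
  move=> i; rewrite -!(inj_eq val_inj) /C3tail_adj /C3tail_arc /=.
  by move=> ii; rewrite (_ : _ || _ = false) ?mul0r //; lia.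
rewrite /C3tail_adj /C3tail_arc /= => E1.
have := vertex_eq (Ordinal ltl).
rewrite (bigD1 (Ordinal ltl')) //= big1; last first.
  move=> i; rewrite -!(inj_eq val_inj) /C3tail_adj /C3tail_arc /= => ii.
  by have lt_in := ltn_ord i; rewrite (_ : _ || _ = false) ?mul0r //; lia.
rewrite /C3tail_adj (_ : _ || _ = true) ?mul1r ?addr0 => [El|]; last first.
  by rewrite /C3tail_arc /=; lia.
have yl : y n.-2 <= y 2 by apply: yd; lia.
have yl' : y n.-1 <= y 2 by apply: yd; lia.
have y10 : y 1 <= y 0 by apply: yd.
have y1_lt0 : y 1 < 0.
  rewrite ltNge; apply/negP => y1_ge0.
  have y01 : y 0 <= y 1 by have := mulr_ge0 (ltW lam0) y1_ge0; lra.
  by have := mulr_gt0 lam0 (lt_le_trans y0 y01); lra.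
have lam1 : 1 < lam.
  rewrite ltNge; apply/negP => lam1.
  have : 0 <= (1 - lam) * - y 1 by rewrite mulr_ge0 ?subr_ge0 ?oppr_ge0 // ltW.
  lra.
have : 0 < (lam - 1) * - y n.-1 by rewrite mulr_gt0 ?subr_gt0 ?oppr_gt0 //; lra.
lra.
Qed.

End TailEigenvector.

(* The sign c = -1 reverses the order: it is used when the pendant vertex is
   among the two largest values, in which case it is not among the two smallest
   ones since n >= 4. *)
Lemma sorted_relabelling (R : realType) n (G : graph n) (f : 'I_n -> R) :
  (4 <= n)%N -> HH 1 G ->
  exists (c : R) (s : {perm 'I_n}), [/\ c ^+ 2 = 1,
    forall i j : 'I_n, (i <= j)%N -> c * f (s j) <= c * f (s i) &
    forall i : 'I_n, (i < 2)%N -> ~~ pendant G (s i)].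
Proof.
move=> hn [cG /eqP/cards1P[p pE]].
have pend i : pendant G i = (i == p) by move/setP: pE => /(_ i); rewrite !inE.
have [s sd] := nonincreasing_perm f.
have [sp|sp] := leqP 2 ((s^-1)%g p).
  exists 1, s; split=> [|i j ij|i i2]; first by rewrite expr1n.
    by rewrite !mul1r sd.
  by rewrite pend; apply: contraTneq i2 => si; rewrite -leqNgt -(permK s i) si.
pose t := perm (@rev_ord_inj n).
exists (- 1), (t * s)%g; split=> [|i j ij|i i2]; first by rewrite sqrrN expr1n.
  rewrite !mulN1r lerN2 !permM !permE sd //=.
  by have := ltn_ord j; lia.
rewrite pend permM permE; apply: contraTneq sp => si.
by rewrite -si permK -leqNgt /=; have := ltn_ord i; lia.
Qed.

(** * Minimality and uniqueness of C_3^{n-3} *)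

Theorem theorem4p5 (R : realType) (n : nat) (hn : (4 <= n)%N) :
  HH 1 (C3tail n) /\
  (forall G : graph n, HH 1 G -> ~ isomorphic G (C3tail n) ->
     algebraic_connectivity R (C3tail n) < algebraic_connectivity R G).
Proof.
split=> [|G hG niso]; first exact: tail_HH.
(* Building an isomorphism from the reverse inequality settles minimality and uniqueness
   together. *)
rewrite ltNge; apply/negP => mu_le; apply: niso.
have [cG _] := hG; have n1 : (1 < n)%N by lia.
have [f f0 [f1 fL]] := fiedler_vector R cG n1.
have [c [s [c1 sd sp]]] := sorted_relabelling (f 0) hn hG.
pose H := relabel G s.
have cH : connected H := relabel_connected s cG.
have degH (i : 'I_n) : (i < 2)%N -> (1 < degree H i)%N.
  move=> i2; have := degree_gt0 i cH n1; have := sp i i2.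
  by rewrite /pendant relabel_degree; lia.
(* The relabelled vector is extended by 0 so that gaps are indexed by natural numbers; only labels
   below [n] matter. *)
pose y k := oapp (fun i => c * f 0 (s i)) 0 (insub k : option 'I_n).
have yE (i : 'I_n) : y i = c * f 0 (s i) by rewrite /y valK.
have yd i j : (i <= j < n)%N -> y j <= y i.
  case/andP=> ij jn; have lt_in := leq_ltn_trans ij jn.
  by have := sd (Ordinal lt_in) (Ordinal jn) ij; rewrite -!yE.
pose z : 'rV[R]_n := \row_i y i.
have zz : (z *m z^T) 0 0 = (f *m f^T) 0 0.
  rewrite !normsq_rV [RHS](reindex_inj (@perm_inj _ s)) /=.
  by apply: eq_bigr => i _; rewrite mxE yE exprMn c1 mul1r.
have z1 : \sum_i z 0 i = 0.
  transitivity (c * \sum_i f 0 i); last by rewrite f1 mulr0.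
  rewrite [in RHS](reindex_inj (@perm_inj _ s)) mulr_sumr.
  by apply: eq_bigr => i _; rewrite mxE yE.
have ff0 := normsq_rV_gt0 f0.
have z0 : z != 0.
  by apply: contraTneq ff0 => z0; rewrite -zz z0 mul0mx mxE ltxx.
have enH : energy H (fun i => y i) = energy G (f 0).
  rewrite -(energy_relabel G s) /energy; apply: eq_bigr => i _.
  by apply: eq_bigr => j _; rewrite !yE -mulrBr exprMn c1 mul1r.
have enL : energy (C3tail n) (fun i => y i) = energy (C3tail n) (z 0).
  rewrite /energy; apply: eq_bigr => i _; apply: eq_bigr => j _.
  by rewrite !mxE.
have mu0 := algebraic_connectivity_gt0 R (tail_connected hn) n1.
have minL := algebraic_connectivity_min (tail_connected hn) n1 z1.
have le_en := energy_tail_le hn cH degH yd.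
have enG : energy G (f 0) = 2 * (algebraic_connectivity R G * (z *m z^T) 0 0).
  by rewrite laplacian_form fL -scalemxAl mxE zz.
have le_mu := ler_wpM2r (ltW ff0) mu_le; rewrite -zz in le_mu.
(* Up to the factor 2, the energy of [z] on the tail graph is at least its [mu] times the squared
   norm and at most the energy on [H], which is [mu] of [G] times that norm. By [mu_le] all are
   equal. *)
have eqz : z *m laplacian R (C3tail n) =
    algebraic_connectivity R (C3tail n) *: z.
  apply/eqP; rewrite -(minL.2) eq_le minL.1 /=.
  rewrite -(ler_pM2l (ltr0Sn R 1)) -laplacian_form -enL.
  apply: le_trans le_en _; rewrite enH enG.
  by rewrite ler_pM2l ?ltr0n.
have enE : energy (C3tail n) (fun i => y i) = energy H (fun i => y i).
  apply/eqP; rewrite eq_le le_en /= enH enG enL laplacian_form eqz -scalemxAl.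
  by rewrite [X in _ <= 2 * X]mxE ler_pM2l ?ltr0n.
have gp := tail_eigenvector_gap hn yd mu0 eqz z1 z0.
have HL := tail_of_arcs hn cH degH (energy_tail_eq hn cH degH yd gp enE).
(* [H] reads [G] through [s], so the inverse carries [G] onto [H], whose adjacency is that of
   [C3tail n]. *)
exists (s^-1)%g => [|i j]; first exact: injF_bij perm_inj.
by rewrite -HL /= !permKV.
Qed.
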